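(* For every $n\in\mathbb{N}$ and every $A\in\mathcal{S}_+^n$, one has $\delta_+(A)=\gamma_+(A)$, that is, $$\gamma_+(A)=\sup\left\{\mathrm{tr}(AT) : T\in\mathcal{S}^n \text{ and } \langle Tx,x\rangle\le 1 \text{ for all } x\in\Sigma_1^n\right\}.$$
   Context: Let $\mathbb{F}$ be $\mathbb{R}$ or $\mathbb{C}$. $\mathcal{S}^n$ is the real vector space of self-adjoint (symmetric or Hermitian) $n\times n$ matrices over $\mathbb{F}$ and $\mathcal{S}_+^n\subset\mathcal{S}^n$ is the cone of positive semidefinite matrices. $\|x\|_1=\sum_{i}|x(i)|$ and $\Sigma_1^n=\{x\in\mathbb{F}^n:\|x\|_1=1\}$. For $A\in\mathcal{S}_+^n$, $\gamma_+(A) := \inf\{\sum_{k=1}^N \|x_k\|_1^2 : N\in\mathbb{N},\ x_k\in\mathbb{F}^n,\ A = \sum_{k=1}^N x_kx_k^*\}$ and $\delta_+(A):=\sup\{\mathrm{tr}(AT) : T\in\mathcal{S}^n,\ \langle Tx,x\rangle\le 1\ \forall x\in\Sigma_1^n\}$. *)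

(* Defs.v *)
From HB Require Import structures.
From mathcomp Require Import all_boot all_order all_algebra.
From mathcomp Require Import sesquilinear complex.
From mathcomp Require Import boolp classical_sets constructive_ereal reals ereal.

Set Implicit Arguments.
Unset Strict Implicit.
Unset Printing Implicit Defensive.

Import Order.TTheory GRing.Theory Num.Theory.
Local Open Scope classical_set_scope.
Local Open Scope ring_scope.
Local Open Scope complex_scope.
Local Open Scope sesquilinear_scope.

Variant scalar_kind := RealScalars | ComplexScalars.

Definition scalar_field (R : realType) (k : scalar_kind) : numFieldType :=
  match k with
  | RealScalars => (R : numFieldType)
  | ComplexScalars => (R[i] : numFieldType)
  end.

Definition sconj (R : realType) (k : scalar_kind) :
    {rmorphism scalar_field R k -> scalar_field R k} :=
  match k return {rmorphism scalar_field R k -> scalar_field R k} with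
  | RealScalars => (idfun : {rmorphism R -> R})
  | ComplexScalars => (Num.conj : {rmorphism R[i] -> R[i]})
  end.

Definition sRe (R : realType) (k : scalar_kind) : scalar_field R k -> R :=
  match k return scalar_field R k -> R with
  | RealScalars => fun x => x
  | ComplexScalars => fun z => complex.Re z
  end.

Section Definitions.
Variables (R : realType) (k : scalar_kind) (n : nat).
Local Notation F := (scalar_field R k).
Local Notation conj := (@sconj R k).

Definition selfadjoint (A : 'M[F]_n) : Prop := A \is hermitianmx n false conj.

(* Linear in the first argument, conjugate-linear in the second. *)
Definition inner (x y : 'cV[F]_n) : F := \sum_(i < n) x i 0 * conj (y i 0).

(* In the partial order on R[i], z <= w forces z and w to have the same
   imaginary part, so [0 <= z] says that z is real and nonnegative. *)
Definition psd (A : 'M[F]_n) : Prop :=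
  selfadjoint A /\ forall x : 'cV[F]_n, 0 <= inner (A *m x) x.

(* The norm `|z| takes its values in F; sRe only casts it to R. *)
Definition norm1 (x : 'cV[F]_n) : R := \sum_(i < n) sRe `|x i 0|.

Definition sphere1 : set 'cV[F]_n := [set x | norm1 x = 1].

(* Infima and suprema are taken in \bar R, where they never take a default
   value. *)
Definition gamma_plus (A : 'M[F]_n) : \bar R :=
  ereal_inf [set r | exists N : nat, exists x : 'I_N -> 'cV[F]_n,
    A = \sum_(j < N) x j *m (x j)^t conj /\
    r = (\sum_(j < N) norm1 (x j) ^+ 2)%:E].

(* The trace of A T is real for self-adjoint A and T. *)
Definition delta_plus (A : 'M[F]_n) : \bar R :=
  ereal_sup [set (sRe (\tr (A *m T)))%:E | T in
    [set T : 'M[F]_n | selfadjoint T /\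
      forall x, sphere1 x -> inner (T *m x) x <= 1]].

End Definitions.

(* Main.v *)
(** The inequality [delta_+ <= gamma_+] is immediate from
    [tr(A T) = sum_k <T x_k, x_k>].  For the converse no separation theorem is
    needed.  Write [^H] for the adjoint, call [(B, v)] decomposable if
    [B = sum x_k x_k^H] and [v = sum ||x_k||_1^2], and take a near-minimizer of the penalized cost
    [v + L |A - B|^2] over decomposable pairs: first-order perturbations show
    that [T = 2 L (A - B)] is almost feasible and that [v] is almost at most
    [tr(B T)], so [v + 2 L |A - B|^2 <= delta_+(A) + e].  It remains to turn a
    cheap decomposition of a [B] close to [A] into one of [A] itself.  With
    [A G A = A], [P = A G] and [E = B - A] one has
    [P B P^H = A + P E P^H], and [t A - P E P^H] is positive semidefinite for
    some [t = O(|E|)], hence decomposable at cost [O(|E|)]; so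
    [(1 + t) A = P B P^H + (t A - P E P^H)] is decomposable, and replacing
    [x_k] by [P x_k] changes the cost little because
    [(P - 1) B (P - 1)^H = (P - 1) E (P - 1)^H]. *)
Require Import Defs.
From HB Require Import structures.
From mathcomp Require Import all_boot all_order all_algebra.
From mathcomp Require Import sesquilinear complex ring lra.
From mathcomp Require Import boolp classical_sets constructive_ereal reals ereal.

Set Implicit Arguments.
Unset Strict Implicit.
Unset Printing Implicit Defensive.

Import Order.TTheory GRing.Theory Num.Theory.
Local Open Scope ring_scope.
Local Open Scope sesquilinear_scope.

(** Supplies the near-minimizer of the penalized cost: a nonempty set bounded below has elements
    arbitrarily close to its infimum. *)
Lemma almost_minimum (R : realType) (S : R -> Prop) (e : R) : 0 < e ->
    (exists x, S x) -> (forall x, S x -> 0 <= x) ->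
  exists2 x, S x & forall y, S y -> x < y + e.
Proof.
move=> e0 [x0 Sx0] Sge.
have lbS : has_lbound S by exists 0 => x /Sge.
have [x Sx xlt] := inf_adherent e0 (conj (ex_intro _ x0 Sx0) lbS : has_inf S).
by exists x => // y Sy; apply: (lt_le_trans xlt); rewrite lerD2r ge_inf.
Qed.

Section Duality.
Variables (R : realType) (k : scalar_kind).
Local Notation F := (scalar_field R k).
Local Notation conj := (@sconj R k).

(** * Scalars: embedding, real part and modulus, uniformly over both fields *)

Definition sinj : {rmorphism R -> F} :=
  match k return {rmorphism R -> scalar_field R k} with
  | RealScalars => (idfun : {rmorphism R -> R})
  | ComplexScalars => (real_complex R : {rmorphism R -> R[i]})
  end.

Lemma sRe_is_zmod_morphism : zmod_morphism (@sRe R k).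
Proof. by case: k => // -[a b] [c d]. Qed.

HB.instance Definition _ :=
  GRing.isZmodMorphism.Build F R (@sRe R k) sRe_is_zmod_morphism.

Lemma sconjK : involutive conj.
Proof. by rewrite /sconj; case: k => // z; exact: conjCK. Qed.

Lemma sqr_norm_sconj (z : F) : `|z| ^+ 2 = z * conj z.
Proof.
rewrite /sconj; case: k z => z /=; last exact: normCK.
by rewrite real_normK ?num_real// expr2.
Qed.

Lemma sinjK : cancel sinj (@sRe R k).
Proof. by rewrite /sinj; case: k. Qed.

Lemma sRe_sinjM r (z : F) : sRe (sinj r * z) = r * sRe z.
Proof. by rewrite /sinj; case: k z => //= -[a b] /=; rewrite mul0r subr0. Qed.

Lemma sRe_conj (z : F) : sRe (conj z) = sRe z.
Proof. by rewrite /sconj; case: k z => // -[a b]. Qed.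

Lemma sinj_sRe (z : F) : conj z = z -> sinj (sRe z) = z.
Proof.
rewrite /sinj /sconj; case: k z => //= -[a b] /eqP.
rewrite eq_complex /= => /andP[_ /eqP hb]; apply/eqP.
by rewrite eq_complex /= eqxx /=; apply/eqP; lra.
Qed.

Lemma conj_sinj r : conj (sinj r) = sinj r.
Proof.
by rewrite /sinj /sconj; case: k => //=; apply/eqP; rewrite eq_complex /= oppr0 !eqxx.
Qed.

Lemma ler_sinj r s : (sinj r <= sinj s) = (r <= s).
Proof. by rewrite /sinj; case: k => //=; rewrite lecE /= eqxx. Qed.

Lemma ler_sRe (z w : F) : z <= w -> sRe z <= sRe w.
Proof. by case: k z w => // z w; rewrite lecE => /andP[]. Qed.

Definition sabs (z : F) : R := sRe `|z|.

Lemma sinj_sabs z : sinj (sabs z) = `|z|.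
Proof.
by rewrite /sabs /sinj; case: k z.
Qed.

Lemma sabs_ge0 z : 0 <= sabs z.
Proof. by rewrite -(raddf0 (@sRe R k)); apply: ler_sRe. Qed.

Lemma sabsM z w : sabs (z * w) = sabs z * sabs w.
Proof. by rewrite /sabs normrM -(sinj_sabs z) sRe_sinjM sinjK. Qed.

Lemma ler_sabsD z w : sabs (z + w) <= sabs z + sabs w.
Proof. by rewrite /sabs -raddfD; apply/ler_sRe/ler_normD. Qed.

Lemma sabsN z : sabs (- z) = sabs z.
Proof. by rewrite /sabs normrN. Qed.

Lemma sabs0 : sabs 0 = 0.
Proof. by rewrite /sabs normr0 raddf0. Qed.

Lemma sqr_sabs z : sabs z ^+ 2 = sRe (z * conj z).
Proof. by rewrite -sqr_norm_sconj -sinj_sabs -rmorphXn sinjK. Qed.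

Lemma sabs_conj z : sabs (conj z) = sabs z.
Proof.
apply/eqP; rewrite -(@eqrXn2 _ 2) ?sabs_ge0//.
by rewrite !sqr_sabs sconjK mulrC.
Qed.

Lemma sabs_sinj r : 0 <= r -> sabs (sinj r) = r.
Proof.
move=> r0; rewrite /sabs ger0_norm ?sinjK//.
by rewrite -(rmorph0 sinj) ler_sinj.
Qed.

Lemma ler_sRe_sabs z : sRe z <= sabs z.
Proof.
rewrite /sabs; case: k z => /= z; first exact: ler_norm.
have := normc_ge_Re z; rewrite lecE => /andP[_] /=.
exact/le_trans/ler_norm.
Qed.

(** * Adjoints, the real Frobenius inner product and entrywise norms *)

Local Notation "X ^h" := (X ^t conj) (at level 2, format "X ^h").

Lemma adjmxM m n p (X : 'M[F]_(m, n)) (Y : 'M[F]_(n, p)) :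
  (X *m Y)^h = Y^h *m X^h.
Proof. by rewrite trmx_mul map_mxM. Qed.

Lemma adjmxK m n (X : 'M[F]_(m, n)) : (X^h)^h = X.
Proof. by apply/matrixP => i j; rewrite !mxE sconjK. Qed.

Lemma adjmxD m n (X Y : 'M[F]_(m, n)) : (X + Y)^h = X^h + Y^h.
Proof. by rewrite linearD map_mxD. Qed.

Lemma adjmxN m n (X : 'M[F]_(m, n)) : (- X)^h = - X^h.
Proof. by rewrite linearN map_mxN. Qed.

Lemma adjmxZ m n r (X : 'M[F]_(m, n)) : (sinj r *: X)^h = sinj r *: X^h.
Proof. by rewrite linearZ map_mxZ conj_sinj. Qed.

Lemma selfadjointP n (A : 'M[F]_n) : selfadjoint A <-> A^h = A.
Proof.
rewrite /selfadjoint qualifE /= expr0 scale1r; split=> [/eqP/esym //|h].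
by apply/eqP.
Qed.

(** Real part of the Frobenius inner product; vectors are the one-column case, so quadratic forms
    and matrix pairings share one calculus. *)
Definition dotmx m n (X Y : 'M[F]_(m, n)) : R := sRe (\tr (X *m Y^h)).
Definition sqnorm m n (X : 'M[F]_(m, n)) : R := dotmx X X.
(** The entrywise 1-norm: submultiplicative, equal to [norm1] on columns, and the measure of size in
    all error bounds. *)
Definition entrysum m n (X : 'M[F]_(m, n)) : R := \sum_i \sum_j sabs (X i j).

Lemma dotmxC m n (X Y : 'M[F]_(m, n)) : dotmx X Y = dotmx Y X.
Proof. by rewrite /dotmx -sRe_conj -trace_map_mx -mxtrace_tr map_trmx adjmxM adjmxK. Qed.

Lemma dotmxDl m n (X Y Z : 'M[F]_(m, n)) : dotmx (X + Y) Z = dotmx X Z + dotmx Y Z.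
Proof. by rewrite /dotmx mulmxDl !raddfD. Qed.

Lemma dotmxNl m n (X Y : 'M[F]_(m, n)) : dotmx (- X) Y = - dotmx X Y.
Proof. by rewrite /dotmx mulNmx !raddfN. Qed.

Lemma dotmxZl m n r (X Y : 'M[F]_(m, n)) : dotmx (sinj r *: X) Y = r * dotmx X Y.
Proof. by rewrite /dotmx -scalemxAl mxtraceZ sRe_sinjM. Qed.

Lemma dotmxDr m n (X Y Z : 'M[F]_(m, n)) : dotmx Z (X + Y) = dotmx Z X + dotmx Z Y.
Proof. by rewrite dotmxC dotmxDl !(dotmxC Z). Qed.

Lemma dotmxNr m n (X Y : 'M[F]_(m, n)) : dotmx Y (- X) = - dotmx Y X.
Proof. by rewrite dotmxC dotmxNl dotmxC. Qed.

Lemma dotmxZr m n r (X Y : 'M[F]_(m, n)) : dotmx Y (sinj r *: X) = r * dotmx Y X.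
Proof. by rewrite dotmxC dotmxZl dotmxC. Qed.

Lemma dotmx_sumr m n I (s : seq I) (X : 'M[F]_(m, n)) (Y : I -> 'M[F]_(m, n)) :
  dotmx X (\sum_(i <- s) Y i) = \sum_(i <- s) dotmx X (Y i).
Proof.
elim: s => [|i s IH]; last by rewrite !big_cons dotmxDr IH.
by rewrite !big_nil -(scale0r X) -(rmorph0 sinj) dotmxZr mul0r.
Qed.

Definition dotmxE := (dotmxDl, dotmxDr, dotmxNl, dotmxNr, dotmxZl, dotmxZr).

Lemma sqnormDZ m n r (X Y : 'M[F]_(m, n)) :
  sqnorm (X + sinj r *: Y) = sqnorm X + 2 * r * dotmx X Y + r ^+ 2 * sqnorm Y.
Proof. by rewrite /sqnorm !dotmxE (dotmxC Y X); ring. Qed.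

Lemma dotmx_mulml m n p (P : 'M[F]_(p, m)) (X : 'M[F]_(m, n)) Y :
  dotmx (P *m X) Y = dotmx X (P^h *m Y).
Proof. by rewrite /dotmx adjmxM adjmxK mulmxA -mulmxA mxtrace_mulC. Qed.

Lemma dotmx_mulmr m n p (X : 'M[F]_(m, n)) (Q : 'M[F]_(n, p)) Y :
  dotmx (X *m Q) Y = dotmx X (Y *m Q^h).
Proof. by rewrite /dotmx adjmxM adjmxK mulmxA. Qed.

Lemma dotmx_sum m n (X Y : 'M[F]_(m, n)) :
  dotmx X Y = \sum_i \sum_j sRe (X i j * conj (Y i j)).
Proof.
rewrite /dotmx raddf_sum; apply: eq_bigr => i _; rewrite mxE raddf_sum.
by apply: eq_bigr => j _; rewrite !mxE.
Qed.

Lemma sqnorm_sum m n (X : 'M[F]_(m, n)) : sqnorm X = \sum_i \sum_j sabs (X i j) ^+ 2.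
Proof.
rewrite /sqnorm dotmx_sum; apply: eq_bigr => i _.
by apply: eq_bigr => j _; rewrite sqr_sabs.
Qed.

Lemma sqnorm_ge0 m n (X : 'M[F]_(m, n)) : 0 <= sqnorm X.
Proof. by rewrite sqnorm_sum; do 2! apply: sumr_ge0 => ? _; rewrite sqr_ge0. Qed.

Lemma entrysum_ge0 m n (X : 'M[F]_(m, n)) : 0 <= entrysum X.
Proof. by do 2! apply: sumr_ge0 => ? _; rewrite sabs_ge0. Qed.

Lemma entrysumN m n (X : 'M[F]_(m, n)) : entrysum (- X) = entrysum X.
Proof. by do 2! apply: eq_bigr => ? _; rewrite mxE sabsN. Qed.

Lemma entrysum_adj m n (X : 'M[F]_(m, n)) : entrysum X^h = entrysum X.
Proof.
rewrite /entrysum exchange_big; do 2! apply: eq_bigr => ? _.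
by rewrite !mxE sabs_conj.
Qed.

Lemma ler_entrysumD m n (X Y : 'M[F]_(m, n)) :
  entrysum (X + Y) <= entrysum X + entrysum Y.
Proof.
rewrite -big_split; apply: ler_sum => i _; rewrite -big_split.
by apply: ler_sum => j _; rewrite mxE ler_sabsD.
Qed.

Lemma ler_sabs_sum I (s : seq I) (f : I -> F) :
  sabs (\sum_(i <- s) f i) <= \sum_(i <- s) sabs (f i).
Proof.
elim: s => [|i s IH]; first by rewrite !big_nil sabs0.
by rewrite !big_cons; apply: le_trans (ler_sabsD _ _) _; rewrite lerD2l.
Qed.

Lemma ler_entrysumM m n p (X : 'M[F]_(m, n)) (Y : 'M[F]_(n, p)) :
  entrysum (X *m Y) <= entrysum X * entrysum Y.
Proof.
rewrite /entrysum mulr_suml; apply: ler_sum => i _.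
apply: (@le_trans _ _ (\sum_j \sum_l sabs (X i l) * sabs (Y l j))).
  apply: ler_sum => j _; rewrite mxE; apply: le_trans (ler_sabs_sum _ _) _.
  by apply: ler_sum => l _; rewrite sabsM.
rewrite exchange_big mulr_suml; apply: ler_sum => l _.
rewrite -mulr_sumr ler_wpM2l ?sabs_ge0//.
rewrite [leRHS](bigD1 l)//= lerDl.
by do 2! apply: sumr_ge0 => ? _; rewrite sabs_ge0.
Qed.

Lemma entrysum_congr_le n (Q E : 'M[F]_n) :
  entrysum (Q *m E *m Q^h) <= entrysum Q ^+ 2 * entrysum E.
Proof.
apply: le_trans (ler_entrysumM _ _) _; rewrite entrysum_adj expr2 mulrAC.
by rewrite ler_wpM2r ?entrysum_ge0// ler_entrysumM.
Qed.

(** Cauchy-Schwarz against the all-ones vector, from $a_i a_j \le (a_i^2+a_j^2)/2$ summed over all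
    pairs. *)
Lemma sqr_sum_le (I : finType) (a : I -> R) :
  (\sum_i a i) ^+ 2 <= #|I|%:R * \sum_i a i ^+ 2.
Proof.
have -> : (\sum_i a i) ^+ 2 = \sum_i \sum_j a i * a j.
  by rewrite expr2 mulr_suml; apply: eq_bigr => i _; rewrite mulr_sumr.
have -> : #|I|%:R * \sum_i a i ^+ 2 = \sum_i \sum_j (a i ^+ 2 + a j ^+ 2) / 2.
  pose S := \sum_j a j ^+ 2.
  transitivity (\sum_i (#|I|%:R * (a i ^+ 2 / 2) + S / 2)).
    rewrite big_split /= sumr_const -mulr_sumr -mulr_suml -/S -[S / 2 *+ _]mulr_natl.
    by field.
  apply: eq_bigr => i _; rewrite -mulr_suml big_split /= sumr_const -/S -[_ *+ #|I|]mulr_natl.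
  by field.
apply: ler_sum => i _; apply: ler_sum => j _.
have := sqr_ge0 (a i - a j); nra.
Qed.

Lemma sqr_entrysum_le m n (X : 'M[F]_(m, n)) :
  entrysum X ^+ 2 <= (m * n)%:R * sqnorm X.
Proof.
rewrite /entrysum sqnorm_sum !pair_big /=.
have -> : (m * n)%N = #|{: 'I_m * 'I_n}| by rewrite card_prod !card_ord.
exact: sqr_sum_le.
Qed.

(** * Quadratic forms and the 1-norm of vectors *)

Lemma norm1E n (x : 'cV[F]_n) : norm1 x = entrysum x.
Proof. by apply: eq_bigr => i _; rewrite big_ord1. Qed.

Lemma sqr_norm1_le n (x : 'cV[F]_n) : norm1 x ^+ 2 <= n%:R * sqnorm x.
Proof. by rewrite norm1E -[X in X%:R * _]muln1; exact: sqr_entrysum_le. Qed.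

(** Termwise, since $|x_i||x_j| \le (|x_i|^2+|x_j|^2)/2 \le \|x\|_2^2$. *)
Lemma dotmx_quad_le n (T : 'M[F]_n) (x : 'cV[F]_n) :
  dotmx (T *m x) x <= entrysum T * sqnorm x.
Proof.
rewrite dotmx_sum /entrysum mulr_suml; apply: ler_sum => i _.
rewrite big_ord1 mxE mulr_suml raddf_sum mulr_suml /=; apply: ler_sum => j _.
apply: le_trans (ler_sRe_sabs _) _; rewrite !sabsM sabs_conj -mulrA.
apply: ler_wpM2l; first exact: sabs_ge0.
have le_sq l : sabs (x l 0) ^+ 2 <= sqnorm x.
  rewrite sqnorm_sum (bigD1 l)//= big_ord1 lerDl.
  by do 2! apply: sumr_ge0 => ? _; rewrite sqr_ge0.
by have := le_sq i; have := le_sq j; have := sqr_ge0 (sabs (x i 0) - sabs (x j 0)); nra.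
Qed.

Lemma sRe_tr_le n (M : 'M[F]_n) : sRe (\tr M) <= entrysum M.
Proof.
rewrite raddf_sum; apply: ler_sum => i _; rewrite (bigD1 i)//=.
apply: le_trans (ler_sRe_sabs _) _; rewrite lerDl.
by apply: sumr_ge0 => ? _; rewrite sabs_ge0.
Qed.

Lemma inner_tr n (x y : 'cV[F]_n) : inner x y = \tr (x *m y^h).
Proof. by apply: eq_bigr => i _; rewrite mxE big_ord1 !mxE. Qed.

(** The form equals its own conjugate, hence is real; this moves inequalities from the partial order
    of [F] to [R]. *)
Lemma inner_quad n (T : 'M[F]_n) (x : 'cV[F]_n) : T^h = T ->
  inner (T *m x) x = sinj (dotmx (T *m x) x).
Proof.
move=> hT; rewrite inner_tr /dotmx sinj_sRe//.
rewrite -trace_map_mx -mxtrace_tr map_trmx adjmxM adjmxK adjmxM hT mulmxA.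
by rewrite mxtrace_mulC mulmxA.
Qed.

Lemma psdP n (A : 'M[F]_n) :
  psd A <-> A^h = A /\ forall x : 'cV[F]_n, 0 <= dotmx (A *m x) x.
Proof.
rewrite /psd selfadjointP; split=> -[hA Age]; split=> // x; have := Age x;
  by rewrite inner_quad// -(rmorph0 sinj) ler_sinj.
Qed.

Lemma dotmx_rank1 n (T : 'M[F]_n) (x : 'cV[F]_n) :
  dotmx T (x *m x^h) = dotmx (T *m x) x.
Proof. by rewrite dotmx_mulmr. Qed.

Lemma norm1Z n r (x : 'cV[F]_n) : 0 <= r -> norm1 (sinj r *: x) = r * norm1 x.
Proof.
move=> r0; rewrite /norm1 mulr_sumr; apply: eq_bigr => i _.
by rewrite -/(sabs _) -/(sabs _) mxE sabsM sabs_sinj.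
Qed.

(** Homogeneity: rescale [x] to the unit sphere. The case [norm1 x = 0] is separate and forces
    [x = 0]. *)
Lemma quad_le_norm1 n (T : 'M[F]_n) :
    (forall x : 'cV[F]_n, norm1 x = 1 -> dotmx T (x *m x^h) <= 1) ->
  forall x : 'cV[F]_n, dotmx T (x *m x^h) <= norm1 x ^+ 2.
Proof.
move=> Tle x; have [x0|xn0] := eqVneq (norm1 x) 0.
  have -> : x = 0.
    apply/matrixP => i j; rewrite mxE (ord1 j); apply/eqP.
    move/eqP: x0; rewrite /norm1 psumr_eq0 => [|l _]; last exact: sabs_ge0.
    move=> /allP/(_ i); rewrite mem_index_enum => /(_ isT) /eqP xi0.
    by rewrite -normr_eq0 -sinj_sabs /sabs xi0 rmorph0.
  by rewrite mul0mx -(scale0r 1%:M) -(rmorph0 sinj) dotmxZr mul0r sqr_ge0.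
have x_gt0 : 0 < norm1 x by rewrite lt_neqAle eq_sym xn0 norm1E entrysum_ge0.
have := Tle (sinj ((norm1 x)^-1) *: x).
rewrite norm1Z; last by rewrite invr_ge0 ltW.
rewrite mulVf// => /(_ erefl).
rewrite !dotmx_rank1 -scalemxAr !dotmxE mulrA -expr2 exprVn.
by rewrite mulrC ler_pdivrMr ?exprn_gt0// mul1r.
Qed.

(** Every entry has modulus at most 1, so its square is at most its modulus, and the moduli sum to
    at most $\|x\|_1^2 = 1$. *)
Lemma sqnorm_rank1_le1 n (x : 'cV[F]_n) : norm1 x = 1 -> sqnorm (x *m x^h) <= 1.
Proof.
move=> x1.
have N1 : entrysum (x *m x^h) <= 1.
  by apply: le_trans (ler_entrysumM _ _) _; rewrite entrysum_adj -norm1E x1 mulr1.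
apply: le_trans N1; rewrite sqnorm_sum; apply: ler_sum => i _; apply: ler_sum => j _.
have le1 l : sabs (x l 0) <= 1.
  rewrite -x1 norm1E /entrysum (bigD1 l)//= big_ord1 lerDl.
  by do 2! apply: sumr_ge0 => ? _; rewrite sabs_ge0.
rewrite expr2 ler_piMr ?sabs_ge0// mxE big_ord1 !mxE sabsM sabs_conj.
by rewrite mulr_ile1 ?sabs_ge0.
Qed.

(** * Decomposable pairs form a convex cone *)

Section Decompositions.
Variable n : nat.
Implicit Types (A B M T : 'M[F]_n) (x : 'cV[F]_n).

(** Sequences rather than indexed families, so that concatenation adds two decompositions. *)
Definition decomp B (v : R) := exists s : seq 'cV[F]_n,
  B = \sum_(x <- s) x *m x^h /\ v = \sum_(x <- s) norm1 x ^+ 2.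

Lemma decomp0 : decomp 0 0.
Proof. by exists [::]; rewrite !big_nil. Qed.

Lemma decomp_rank1 x : decomp (x *m x^h) (norm1 x ^+ 2).
Proof. by exists [:: x]; rewrite !big_seq1. Qed.

Lemma decompD B v B' v' : decomp B v -> decomp B' v' -> decomp (B + B') (v + v').
Proof. by move=> [s [-> ->]] [s' [-> ->]]; exists (s ++ s'); rewrite !big_cat. Qed.

Lemma decompZ B v r : 0 <= r -> decomp B v -> decomp (sinj r *: B) (r * v).
Proof.
move=> r0 [s [-> ->]]; exists [seq sinj (Num.sqrt r) *: x | x <- s].
rewrite !big_map scaler_sumr mulr_sumr; split; apply: eq_bigr => x _.
  by rewrite adjmxZ -scalemxAl -scalemxAr scalerA -rmorphM -expr2 sqr_sqrtr.
by rewrite norm1Z ?sqrtr_ge0// exprMn sqr_sqrtr.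
Qed.

Lemma decomp_ge0 B v : decomp B v -> 0 <= v.
Proof. by move=> [s [_ ->]]; apply: sumr_ge0 => x _; rewrite sqr_ge0. Qed.

Lemma adj_rank1 x : (x *m x^h)^h = x *m x^h.
Proof. by rewrite adjmxM adjmxK. Qed.

Lemma decomp_adj B v : decomp B v -> B^h = B.
Proof.
move=> [s [-> _]]; elim: s => [|x s IH].
  by rewrite big_nil; apply/matrixP => i j; rewrite !mxE rmorph0.
by rewrite big_cons adjmxD IH adj_rank1.
Qed.

Lemma decomp_le_tr B v : decomp B v -> v <= n%:R * sRe (\tr B).
Proof.
move=> [s [-> ->]]; rewrite linear_sum raddf_sum mulr_sumr; apply: ler_sum => x _.
exact: sqr_norm1_le.
Qed.

(** * Positive semidefinite matrices are decomposable *)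

(** A form of $M^2 \le \|M\| M$. Positivity at $(N+1)x - Mx$ gives $(N+1)^2 q - 2(N+1)Q + z \ge 0$,
    and $z \le NQ$; the added 1 keeps the factor positive when [M = 0]. *)
Lemma psd_sqnorm_le M x : M^h = M -> (forall y : 'cV[F]_n, 0 <= dotmx (M *m y) y) ->
  sqnorm (M *m x) <= (entrysum M + 1) * dotmx (M *m x) x.
Proof.
move=> hM Mge; set N := entrysum M.
have N0 : 0 < N + 1 by have := entrysum_ge0 M; rewrite -/N; lra.
have := Mge ((sinj (N + 1)) *: x - M *m x).
rewrite mulmxBr -scalemxAr !dotmxE.
rewrite -[dotmx (M *m x) (M *m x)]/(sqnorm _).
rewrite [dotmx (M *m (M *m x)) x]dotmx_mulml hM -[dotmx (M *m x) (M *m x)]/(sqnorm _).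
have := dotmx_quad_le M (M *m x); rewrite -/N.
set q := dotmx (M *m x) x; set Q := sqnorm _; set z := dotmx _ _ => zle.
move=> h; rewrite -(ler_pM2l N0); have := sqnorm_ge0 (M *m x); rewrite -/Q; nra.
Qed.

(* The new quadratic form at x is the old one at x - (<M x, e_i> / a) e_i. *)
Lemma sub_schur_psd M i : M^h = M -> (forall x : 'cV[F]_n, 0 <= dotmx (M *m x) x) ->
  let a := sRe (M i i) in 0 < a ->
  let y := sinj ((Num.sqrt a)^-1) *: col i M in
  forall x : 'cV[F]_n, 0 <= dotmx ((M - y *m y^h) *m x) x.
Proof.
move=> hM Mge a a0 y x; pose e : 'cV[F]_n := delta_mx i 0.
have cE : col i M = M *m e by rewrite colE.
(* The coefficient [t] is a 1 by 1 matrix, so that [dotmx_mulml] can move the factors around it. *)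
pose c := M *m e; pose t : 'M[F]_1 := sinj (a^-1) *: (c^h *m x).
have Mii : M i i = sinj a by rewrite sinj_sRe// -{2}hM !mxE.
have ec : e^h *m c = sinj a *: 1%:M.
  apply/matrixP => p q; rewrite !ord1 /c -cE mxE (bigD1 i)//= !mxE !eqxx rmorph1 mul1r.
  rewrite big1 ?addr0 ?mulr1// => j ji; rewrite !mxE (negPf ji) /=.
  by rewrite rmorph0 mul0r.
have := Mge (x - e *m t).
rewrite mulmxBr mulmxA -/c !dotmxE.
have -> : dotmx (M *m x) (e *m t) = a^-1 * sqnorm (c^h *m x).
  by rewrite dotmx_mulml hM mulmxA -/c dotmxC dotmx_mulml dotmxE.
have -> : dotmx (c *m t) (e *m t) = a^-1 * sqnorm (c^h *m x).
  rewrite dotmxC dotmx_mulml mulmxA ec -scalemxAl mul1mx dotmxE /t !dotmxE.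
  by rewrite (mulrA a) mulfV ?gt_eqF// mul1r.
have -> : dotmx (c *m t) x = a^-1 * sqnorm (c^h *m x).
  by rewrite dotmx_mulml dotmxE.
have -> : y *m y^h = sinj (a^-1) *: (c *m c^h).
  rewrite /y cE -/c adjmxZ -scalemxAl -scalemxAr scalerA -rmorphM -invfM -expr2.
  by rewrite sqr_sqrtr// ltW.
rewrite mulmxBl -scalemxAl -mulmxA !dotmxE (dotmx_mulml c) /sqnorm; lra.
Qed.

Lemma quad_delta M j :
  dotmx (M *m delta_mx j 0) (delta_mx j 0 : 'cV[F]_n) = sRe (M j j).
Proof.
rewrite -colE dotmx_sum (bigD1 j)//= big_ord1 !mxE !eqxx rmorph1 mulr1.
rewrite big1 ?addr0// => i ij; rewrite big_ord1 !mxE (negPf ij) /=.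
by rewrite rmorph0 mulr0 raddf0.
Qed.

Lemma sqnorm_eq0 m p (X : 'M[F]_(m, p)) : sqnorm X = 0 -> X = 0.
Proof.
rewrite sqnorm_sum => /eqP; rewrite psumr_eq0 => [/allP X0|i _]; last first.
  by apply: sumr_ge0 => j _; rewrite sqr_ge0.
apply/matrixP => i j; have := X0 i; rewrite mem_index_enum => /(_ isT) /=.
rewrite psumr_eq0 => [/allP/(_ j)|l _]; last by rewrite sqr_ge0.
rewrite mem_index_enum mxE => /(_ isT) /=; rewrite sqrf_eq0 => /eqP Xij0.
by apply/eqP; rewrite -normr_eq0 -sinj_sabs Xij0 rmorph0.
Qed.

(** [psd_sqnorm_le] at the basis vector $e_j$ bounds the squared norm of column [j] by a multiple of
    $M_{jj}$. *)
Lemma psd_diag_eq0 M j : M^h = M -> (forall x : 'cV[F]_n, 0 <= dotmx (M *m x) x) ->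
  M j j = 0 -> forall i, M i j = 0.
Proof.
move=> hM Mge Mjj i; have := psd_sqnorm_le (delta_mx j 0) hM Mge.
rewrite quad_delta Mjj raddf0 mulr0 => le0.
have /matrixP/(_ i 0) : col j M = 0.
  by apply: sqnorm_eq0; rewrite colE; apply/eqP; rewrite eq_le le0 sqnorm_ge0.
by rewrite !mxE.
Qed.

(** Cholesky elimination with a nonzero pivot [i], by induction on a bound for the number of nonzero
    diagonal entries: zero diagonal entries have zero columns and stay zero, while entry [i] is
    cleared. *)
Lemma psd_decomp M : M^h = M -> (forall x : 'cV[F]_n, 0 <= dotmx (M *m x) x) ->
  exists v, decomp M v.
Proof.
move: {2}(#|_|) (leqnn #|[set j | M j j != 0]|) => m.
elim: m M => [|m IH] M lem hM Mge.
  exists 0; suff -> : M = 0 by exact: decomp0.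
  apply/matrixP => i j; rewrite mxE; apply: (psd_diag_eq0 hM Mge).
  apply/eqP; apply/negPn/negP => Mjj.
  by move: lem; rewrite leqn0 cards_eq0 => /eqP/setP/(_ j); rewrite !inE Mjj.
have [/forallP M0|/forallPn[i Mii]] := boolP [forall i, M i i == 0].
  exists 0; suff -> : M = 0 by exact: decomp0.
  by apply/matrixP => i j; rewrite mxE; apply: (psd_diag_eq0 hM Mge); apply/eqP.
pose a := sRe (M i i).
have Ma : sinj a = M i i by rewrite sinj_sRe// -{2}hM !mxE.
have a0 : 0 < a.
  rewrite lt_neqAle -{2}[a]quad_delta Mge andbT eq_sym.
  by apply: contraNneq Mii => a0; rewrite -Ma a0 rmorph0.
pose y := sinj ((Num.sqrt a)^-1) *: col i M.
have yE p q : (y *m y^h) p q = sinj (a^-1) * (M p i * conj (M q i)).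
  rewrite mxE big_ord1 !mxE rmorphM conj_sinj mulrACA -rmorphM -invfM -expr2.
  by rewrite sqr_sqrtr// ltW.
have [|||v Mv] := IH (M - y *m y^h); last 1 first.
- by exists (v + norm1 y ^+ 2); rewrite -[M](subrK (y *m y^h)); apply/decompD/decomp_rank1.
- rewrite -ltnS; apply: leq_trans lem; apply/proper_card/properP; split.
    apply/fintype.subsetP => j; rewrite !inE; apply: contraNneq => Mjj.
    rewrite mxE [X in _ + X]mxE yE Mjj -hM !mxE (psd_diag_eq0 hM Mge Mjj).
    by rewrite rmorph0 !(mul0r, mulr0) subr0.
  exists i; rewrite !inE// mxE [X in _ + X]mxE yE -Ma conj_sinj -!rmorphM.
  by rewrite (mulKf (lt0r_neq0 a0)) subrr eqxx.
- by rewrite adjmxD adjmxN adj_rank1 hM.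
- exact: sub_schur_psd.
Qed.

(** * Stability of decompositions and the penalized problem *)

Lemma decomp_congr B v (P : 'M[F]_n) (h : R) : 0 < h -> decomp B v ->
  exists w, decomp (P *m B *m P^h) w /\
    w <= (1 + h) * v + (1 + h^-1) * (n%:R * sRe (\tr ((P - 1%:M) *m B *m (P - 1%:M)^h))).
Proof.
move=> h0 [s [-> ->]]; exists (\sum_(x <- s) norm1 (P *m x) ^+ 2); split.
  exists [seq P *m x | x <- s]; rewrite !big_map mulmx_sumr mulmx_suml; split=> //.
  by apply: eq_bigr => x _; rewrite adjmxM !mulmxA.
rewrite mulmx_sumr mulmx_suml linear_sum raddf_sum !mulr_sumr -big_split /=.
apply: ler_sum => x _; set Q := P - 1%:M.
have -> : Q *m (x *m x^h) *m Q^h = (Q *m x) *m (Q *m x)^h.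
  by rewrite adjmxM !mulmxA.
have := sqr_norm1_le (Q *m x); rewrite /sqnorm /dotmx.
have Px : norm1 (P *m x) <= norm1 x + norm1 (Q *m x).
  have -> : P *m x = x + Q *m x by rewrite mulmxBl mul1mx addrC subrK.
  by rewrite !norm1E ler_entrysumD.
have : 0 <= norm1 (P *m x) by rewrite norm1E entrysum_ge0.
set b := norm1 (Q *m x); set c := norm1 x; set z := n%:R * _.
move=> p0 bz; have : norm1 (P *m x) ^+ 2 <= (c + b) ^+ 2.
  by rewrite ler_sqr ?nnegrE// (le_trans p0).
move=> /le_trans; apply.
have : (1 + h^-1) * b ^+ 2 <= (1 + h^-1) * z.
  by rewrite ler_wpM2l// addr_ge0// invr_ge0 ltW.
have : 2 * c * b <= h * c ^+ 2 + h^-1 * b ^+ 2; last by nra.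
have := sqr_ge0 (h * c - b); have i0 : 0 < h^-1 by rewrite invr_gt0.
rewrite -(pmulr_rge0 _ i0) => hh.
have -> : h * c ^+ 2 + h^-1 * b ^+ 2 = h^-1 * (h * c - b) ^+ 2 + 2 * c * b.
  by field; rewrite gt_eqF.
by rewrite lerDr.
Qed.

(** As $P^* = G^*A$, the error form at [x] is that of $GEG^*$ at $Ax$, and [psd_sqnorm_le] bounds
    $\|Ax\|_2^2$ by a multiple of $\langle Ax,x\rangle$. Hence a multiple of [A] dominates the error
    even when [A] is singular. *)
Lemma psd_error_absorb A E (G : 'M[F]_n) :
    A^h = A -> (forall x, 0 <= dotmx (A *m x) x) -> E^h = E ->
  let t := (entrysum A + 1) * entrysum G ^+ 2 * entrysum E in
  let P := A *m G in
  forall x, 0 <= dotmx ((sinj t *: A - P *m E *m P^h) *m x) x.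
Proof.
move=> hA Age hE t P x.
rewrite mulmxBl -scalemxAl !dotmxE.
have -> : dotmx (P *m E *m P^h *m x) x = dotmx (G *m E *m G^h *m (A *m x)) (A *m x).
  rewrite [RHS]dotmxC [RHS]dotmx_mulml hA [RHS]dotmxC /P adjmxM hA.
  by rewrite !mulmxA.
have le1 := dotmx_quad_le (G *m E *m G^h) (A *m x).
have le2 := entrysum_congr_le G E.
have le3 := psd_sqnorm_le x hA Age.
rewrite subr_ge0; apply: le_trans le1 _.
apply: le_trans (ler_wpM2r (sqnorm_ge0 _) le2) _.
have := ler_wpM2l (mulr_ge0 (sqr_ge0 (entrysum G)) (entrysum_ge0 E)) le3.
by move=> /le_trans; apply; rewrite /t; lra.
Qed.

(* Lower semicontinuity of gamma_+, including at singular A. *)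
Lemma decomp_limit A (d e : R) :
    A^h = A -> (forall x, 0 <= dotmx (A *m x) x) -> 0 <= d -> 0 < e ->
  exists2 r, 0 < r & forall B v, decomp B v -> v <= d -> sqnorm (A - B) <= r ->
    exists2 v', decomp A v' & v' <= d + e.
Proof.
move=> hA Age d0 e0; pose G := pinvmx A; pose P := A *m G.
have PA : P *m A = A by apply: mulmxKpV.
(* The budget [e] is halved: [h] keeps the loss $hd$ below $e/2$, and the rest pays for the terms
   linear in [E]. *)
pose h := e / (2 * (d + 1)); have h0 : 0 < h by apply: divr_gt0; lra.
have hd : h * d <= e / 2.
  rewrite /h mulrAC ler_pdivrMr ?mulr_gt0//; last lra.
  have -> : e / 2 * (2 * (d + 1)) = e * d + e by field.
  by rewrite lerDl ltW.
pose gA := (entrysum A + 1) * entrysum G ^+ 2.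
(* [C] collects the coefficients of [entrysum E]: first the distortion caused by [P], then the cost
   of the correction [M]. *)
pose C := (1 + h^-1) * n%:R * entrysum (P - 1%:M) ^+ 2 +
          n%:R * (gA * entrysum A + entrysum P ^+ 2).
have ih0 : 0 < h^-1 by rewrite invr_gt0.
have gA0 : 0 <= gA.
  by rewrite mulr_ge0 ?sqr_ge0// addr_ge0 ?entrysum_ge0.
have C0 : 0 <= C.
  apply: addr_ge0.
    by rewrite mulr_ge0 ?sqr_ge0// mulr_ge0 ?ler0n// addr_ge0// ltW.
  by rewrite mulr_ge0// addr_ge0 ?sqr_ge0// mulr_ge0 ?entrysum_ge0.
pose r := e / (2 * (C + 1)); have r0 : 0 < r by apply: divr_gt0; lra.
have Cr : C * r <= e / 2.
  rewrite /r mulrA ler_pdivrMr ?mulr_gt0//; last lra.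
  have -> : e / 2 * (2 * (C + 1)) = C * e + e by field.
  by rewrite lerDl ltW.
have n1 : 0 < n%:R + 1 :> R by rewrite ltr_wpDl.
(* The entry sum is at most $n$ times the Frobenius norm; $n+1$ also avoids dividing by zero when
   [n = 0]. *)
exists ((r / (n%:R + 1)) ^+ 2); first by rewrite exprn_gt0// divr_gt0.
move=> B v Bv vd ABle; have hB := decomp_adj Bv; have v0 := decomp_ge0 Bv.
pose E := B - A; have hE : E^h = E by rewrite adjmxD adjmxN hA hB.
have BE : B = A + E by rewrite addrC subrK.
have Er : entrysum E <= r.
  rewrite -(@ler_sqr _ (entrysum E)) ?nnegrE ?entrysum_ge0 ?(ltW r0)//.
  apply: le_trans (sqr_entrysum_le E) _.
  have : sqnorm E <= (r / (n%:R + 1)) ^+ 2.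
    by rewrite -[E]opprK opprB /sqnorm dotmxNl dotmxNr opprK.
  move=> /(ler_wpM2l (ler0n R (n * n))) /le_trans; apply.
  rewrite expr_div_n mulrA ler_pdivrMr ?exprn_gt0// mulrC ler_wpM2l ?sqr_ge0//.
  by rewrite natrM -expr2 ler_sqr ?nnegrE ?lerDl// ltW.
(* Since $(P-1)A = 0$, the distortion sees only [E]. *)
have Qh : (P - 1%:M) *m B *m (P - 1%:M)^h = (P - 1%:M) *m E *m (P - 1%:M)^h.
  by rewrite BE mulmxDr mulmxDl [(P - 1%:M) *m A]mulmxBl PA mul1mx subrr mul0mx add0r.
have PAP : P *m A *m P^h = A by rewrite PA -{1}hA -adjmxM PA hA.
have [w [Bw wle]] := decomp_congr P h0 Bv.
pose t := gA * entrysum E.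
have t0 : 0 <= t by rewrite mulr_ge0 ?entrysum_ge0.
pose M := sinj t *: A - P *m E *m P^h.
have hPE : (P *m E *m P^h)^h = P *m E *m P^h by rewrite adjmxM adjmxK adjmxM hE mulmxA.
have hM : M^h = M by rewrite adjmxD adjmxN adjmxZ hPE hA.
have [u Mu] := psd_decomp hM (psd_error_absorb G hA Age hE).
have Mle : entrysum M <= (gA * entrysum A + entrysum P ^+ 2) * entrysum E.
  apply: le_trans (ler_entrysumD _ _) _; rewrite entrysumN.
  have := entrysum_congr_le P E; have -> : entrysum (sinj t *: A) = t * entrysum A.
    rewrite /entrysum mulr_sumr; apply: eq_bigr => i _; rewrite mulr_sumr.
    by apply: eq_bigr => j _; rewrite mxE sabsM sabs_sinj.
  by rewrite /t; lra.
have ule := decomp_le_tr Mu.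
have t1 : 0 < 1 + t by lra.
have Atw : decomp A ((1 + t)^-1 * (w + u)).
  have -> : A = sinj ((1 + t)^-1) *: (P *m B *m P^h + M).
    have -> : P *m B *m P^h = A + P *m E *m P^h by rewrite BE mulmxDr mulmxDl PAP.
    rewrite /M addrACA subrr addr0.
    have -> : A + sinj t *: A = sinj (1 + t) *: A.
      by rewrite rmorphD rmorph1 scalerDl scale1r.
    by rewrite scalerA -rmorphM mulVf ?gt_eqF// rmorph1 scale1r.
  by apply: decompZ (decompD Bw Mu); rewrite invr_ge0 ltW.
exists ((1 + t)^-1 * (w + u)) => //.
have wu0 : 0 <= w + u by rewrite addr_ge0 ?(decomp_ge0 Bw) ?(decomp_ge0 Mu).
apply: (@le_trans _ _ (w + u)).
  by rewrite ler_piMl// invf_le1//; lra.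
rewrite {}Qh in wle.
have w2 : w <= (1 + h) * v + (1 + h^-1) * (n%:R * (entrysum (P - 1%:M) ^+ 2 * entrysum E)).
  apply: le_trans wle _; rewrite lerD2l ler_wpM2l ?addr_ge0 ?(ltW ih0)//.
  by rewrite ler_wpM2l// (le_trans (sRe_tr_le _))// entrysum_congr_le.
have u2 : u <= n%:R * ((gA * entrysum A + entrysum P ^+ 2) * entrysum E).
  by apply: le_trans ule _; rewrite ler_wpM2l// (le_trans (sRe_tr_le _)).
have hv : (1 + h) * v <= d + h * d.
  by rewrite mulrDl mul1r lerD// ler_wpM2l// ltW.
have : C * entrysum E <= C * r by rewrite ler_wpM2l.
rewrite /C in Cr *; lra.
Qed.

(* Perturbing the near-minimizer B to B + h x x^h makes T = 2 L (A - B) nearly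
   feasible; perturbing it to (1 - h) B gives v <= tr(B T) + O(h). *)
Lemma penalized_decomp A (d L e : R) :
    A^h = A -> 0 < L -> 0 < e ->
    (forall T, T^h = T -> (forall x, norm1 x = 1 -> dotmx T (x *m x^h) <= 1) ->
      dotmx A T <= d) ->
  exists B v, decomp B v /\ v + 2 * L * sqnorm (A - B) <= d + e.
Proof.
move=> hA L0 e0 Ad.
have adj0 : (0 : 'M[F]_n)^h = 0 by apply/matrixP => i j; rewrite !mxE rmorph0.
have dot0 X : dotmx (0 : 'M[F]_n) X = 0.
  by rewrite -(scale0r X) -(rmorph0 sinj) dotmxZl mul0r.
have d0 : 0 <= d.
  by rewrite -(dot0 A) dotmxC; apply: Ad => // x _; rewrite dot0 ler01.
have A0 := sqnorm_ge0 A.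
(* [K] will bound $L\|B\|^2$: compare with the pair $(0,0)$ and use $\|B\|^2 \le 2\|A\|^2 +
   2\|A-B\|^2$. *)
pose K := 4 * L * sqnorm A + 2.
(* Total error per unit of [h]: $1+K$ from shrinking [B], $(1+L)d$ from rescaling [T] to be
   feasible. *)
pose K1 := 1 + K + (1 + L) * d.
have K0 : 0 <= K by rewrite /K; nra.
have K10 : 0 < K1 by rewrite /K1; nra.
pose h := e / (K1 + e); have h0 : 0 < h by apply: divr_gt0; lra.
have h1 : h <= 1 by rewrite /h ler_pdivrMr; lra.
have hK : h * K1 <= e.
  by rewrite /h mulrAC ler_pdivrMr; nra.
pose H := [set y | exists B v, decomp B v /\ y = v + L * sqnorm (A - B)]%classic.
(* A tolerance $h^2$ costs only [h] once the perturbation inequalities are divided by the step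
   [h]. *)
have [|||_ [B [v [Bv ->]]] Hmin] := @almost_minimum R H (h ^+ 2).
- by rewrite exprn_gt0.
- by exists (0 + L * sqnorm (A - 0)), 0, 0; split=> //; exact: decomp0.
- move=> _ [B [v [Bv ->]]]; rewrite addr_ge0 ?(decomp_ge0 Bv)//.
  by rewrite mulr_ge0 ?sqnorm_ge0// ltW.
have {}Hmin B' v' : decomp B' v' ->
    v + L * sqnorm (A - B) < v' + L * sqnorm (A - B') + h ^+ 2.
  by move=> Bv'; apply: Hmin; exists B', v'.
have v0 := decomp_ge0 Bv; have hB := decomp_adj Bv.
have BK : L * sqnorm B <= K.
  have := Hmin _ _ decomp0; have := sqnorm_ge0 (A + (A - B)).
  rewrite /sqnorm subr0 !dotmxE (dotmxC B A) /K /sqnorm.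
  have : h ^+ 2 <= 1 by rewrite expr_le1// ltW.
  move: (dotmx A A) (dotmx A B) (dotmx B B) => a b c; nra.
pose T := sinj (2 * L) *: (A - B).
have hT : T^h = T by rewrite adjmxZ adjmxD adjmxN hA hB.
have Tfeas x : norm1 x = 1 -> dotmx T (x *m x^h) <= 1 + h * (1 + L).
  move=> x1; set X := x *m x^h.
  have := Hmin _ _ (decompD Bv (decompZ (ltW h0) (decomp_rank1 x))).
  have -> : A - (B + sinj h *: X) = (A - B) + sinj (- h) *: X.
    by rewrite rmorphN scaleNr opprD addrA.
  have := sqnorm_rank1_le1 x1; rewrite -/X x1 expr1n mulr1 /T dotmxZl sqnormDZ.
  move: (sqnorm (A - B)) (dotmx (A - B) X) (sqnorm X) => z p q q1 lt1.
  have qh := ler_wpM2l (mulr_ge0 (ltW L0) (sqr_ge0 h)) q1.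
  by rewrite -(ler_pM2l h0); lra.
have TB : v - h * (1 + K) <= dotmx T B.
  have h1' : 0 <= 1 - h by lra.
  have := Hmin _ _ (decompZ h1' Bv).
  have -> : A - sinj (1 - h) *: B = (A - B) + sinj h *: B.
    by rewrite rmorphB rmorph1 scalerBl scale1r opprB addrA addrAC.
  rewrite /T dotmxZl sqnormDZ.
  move: (sqnorm (A - B)) (dotmx (A - B) B) (sqnorm B) BK => z p q qK lt1.
  have qh := ler_wpM2l (sqr_ge0 h) qK.
  by rewrite -(ler_pM2l h0); lra.
(* Dividing by [c] makes [T] exactly feasible. *)
pose c := 1 + h * (1 + L); have c0 : 0 < c by rewrite /c; nra.
have : dotmx A (sinj (c^-1) *: T) <= d.
  apply: Ad => [|x /Tfeas xT]; first by rewrite adjmxZ hT.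
  by rewrite dotmxE mulrC ler_pdivrMr// mul1r.
rewrite dotmxE mulrC ler_pdivrMr// => AT.
exists B, v; split=> //.
have : dotmx A T = dotmx T B + 2 * L * sqnorm (A - B).
  have {1}-> : A = B + (A - B) by rewrite addrC subrK.
  by rewrite dotmxDl (dotmxC B T) /T !dotmxZr.
move: AT TB hK; rewrite /c /K1; lra.
Qed.

(** * Extended-real values and the two inequalities *)

Lemma gamma_plus_le_decomp A v : decomp A v -> (gamma_plus A <= v%:E)%E.
Proof.
move=> [s [As ->]]; apply: ereal_inf_lbound.
exists (size s), (tnth (in_tuple s)); split; first by rewrite As; exact: big_tnth.
by congr EFin; exact: big_tnth.
Qed.

End Decompositions.
End Duality.

Theorem theorem3p2 (R : realType) (k : scalar_kind) (n : nat)
    (A : 'M[scalar_field R k]_n) (hA : psd A) :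
  delta_plus A = gamma_plus A.
Proof.
move/psdP: hA => [hA Age]; apply/eqP; rewrite eq_le; apply/andP; split.
  apply: ub_ereal_sup => _ [T [/selfadjointP hT Tle] <-].
  apply: le_ereal_inf_tmp => _ [N [x [AE ->]]].
  rewrite lee_fin -{1}hT -/(dotmx A T) dotmxC AE dotmx_sumr.
  (* Feasibility on the sphere extends to every vector by homogeneity, so each rank-one term is
     bounded separately. *)
  apply: ler_sum => j _; apply: quad_le_norm1 => y y1.
  have := Tle y y1; rewrite inner_quad// -(rmorph1 (sinj R k)) ler_sinj.
  by rewrite dotmx_rank1.
(* The value $+\infty$ is trivial, and $-\infty$ is excluded by the feasible [T = 0]. *)
case dE: (delta_plus A) => [d||]; last 2 first.
- by rewrite leey.
- suff : (0%:E <= delta_plus A)%E by rewrite dE.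
  apply: ereal_sup_ubound; exists 0; last by rewrite mulmx0 mxtrace0 raddf0.
  split=> [|x _]; first by apply/selfadjointP; rewrite trmx0 map_mx0.
  by rewrite mul0mx inner_tr mul0mx mxtrace0 ler01.
have Ad (T : 'M_n) : T ^t (@sconj R k) = T ->
    (forall x : 'cV_n, norm1 x = 1 -> dotmx T (x *m x ^t (@sconj R k)) <= 1) ->
  dotmx A T <= d.
  move=> hT Tle; rewrite -lee_fin -dE; apply: ereal_sup_ubound.
  exists T; last by rewrite /dotmx hT.
  split=> [|x x1]; first exact/selfadjointP.
  by rewrite inner_quad// -(rmorph1 (sinj R k)) ler_sinj -dotmx_rank1 Tle.
have d0 : 0 <= d.
  rewrite -(raddf0 (@sRe R k)) -(mxtrace0 _ n) -(mulmx0 _ A).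
  have := Ad 0; rewrite /dotmx trmx0 map_mx0; apply=> // x _.
  by rewrite mul0mx mxtrace0 raddf0 ler01.
apply/lee_addgt0Pr => e e0; have e20 : 0 < e / 2 by rewrite divr_gt0.
(* One half of [e] is for the penalized problem, the other for passing from [B] to [A]; the radius
   [r] is fixed before [L]. *)
have [r r0 Hr] := decomp_limit hA Age (addr_ge0 d0 (ltW e20)) e20.
(* Chosen so that $2L\|A-B\|^2 \le d+e/2$ forces $\|A-B\|^2 \le r$. *)
pose L := (d + e / 2) / (2 * r).
have de0 : 0 < d + e / 2 by rewrite ltr_wpDl.
have L0 : 0 < L by rewrite divr_gt0// mulr_gt0.
have [B [v [Bv BL]]] := penalized_decomp hA L0 e20 Ad.
have v0 := decomp_ge0 Bv; have AB0 := sqnorm_ge0 (A - B).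
have [||v' Av' v'le] := Hr B v Bv.
- have LAB : 0 <= L * sqnorm (A - B) by rewrite mulr_ge0// ltW.
  by lra.
- have L2 : 2 * L = (d + e / 2) / r by rewrite /L; field; rewrite gt_eqF.
  have : 2 * L * sqnorm (A - B) <= d + e / 2 by apply: le_trans BL; rewrite lerDr.
  by rewrite L2 mulrAC ler_pdivrMr// ler_pM2l.
apply: le_trans (gamma_plus_le_decomp Av') _.
by rewrite -EFinD lee_fin (le_trans v'le)// -addrA -splitr.
Qed.
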